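(* Let $n\ge2$, $k\ge1$, $i_1,\dots,i_k\in\{1,\dots,n-1\}$, $j\in\{1,\dots,k\}$, and fix integers $a_h$ for $h\ne j$. For $e\in\mathbb{Z}$ put $V_n(e)=V_n(x_{i_1}^{a_1}\cdots x_{i_j}^{e}\cdots x_{i_k}^{a_k})$ (the $j$-th exponent replaced by $e$). Then the sequence $(V_n(e))_{e\in\mathbb{Z}}$ contains at most two terms equal to $1$, and if $V_n(a)=V_n(b)=1$ with $a\ne b$ then $|a-b|=2$.
   Context: $\mathcal{B}_n$ is the Artin braid group with standard generators $x_1,\dots,x_{n-1}$; $V_n(\beta)$ is the Jones polynomial of the closure $\widehat\beta$, normalized by $V(\text{unknot})=1$ and $q^{-1}V_{L_+}-qV_{L_-}=(q^{1/2}-q^{-1/2})V_{L_0}$, written in $s=q^{-1/2}$. Conventions: closures of $\alpha x_i^{e+2}\gamma$, $\alpha x_i^{e+1}\gamma$, $\alpha x_i^{e}\gamma$ play the roles of $L_-,L_0,L_+$ (e.g. the closure of $x_1^2\in\mathcal B_2$ has Jones polynomial $-s-s^5$). *)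

(* Defs.v *)
From HB Require Import structures.
From mathcomp Require Import all_boot all_order all_algebra.
From mathcomp Require Import fraction.
Set Implicit Arguments. Unset Strict Implicit. Unset Printing Implicit Defensive.
Import Order.TTheory GRing.Theory Num.Theory.
Local Open Scope ring_scope.

(* Coefficient field: Q(A) = fraction field of Z[A]; Laurent polynomials in A
   embed in it.  The variable s = q^{-1/2} of the paper is s = A^2. *)
Definition LField := {fraction {poly int}}.
Definition Avar : LField := FracField.tofrac 'X.
Definition loopval : LField := - Avar ^+ 2 - Avar ^- 2.

(* A braid word: a letter (i, true) is the generator x_i, (i, false) is x_i^{-1};
   x_i acts on the strands i, i+1 (1-indexed), i.e. positions i-1, i (0-indexed). *)
Definition bword := seq (nat * bool).

(* Vertices of the closed braid diagram: level t in 0..m (m = length of the word)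
   and strand position p < n; level m is glued to level 0 by the closure.
   A state S assigns to crossing t the identity smoothing (S t = true)
   or the cup-cap smoothing (S t = false). *)
Definition state_adj (n : nat) (w : bword) (S : {ffun 'I_(size w) -> bool})
  (u v : 'I_(size w).+1 * 'I_n) : bool :=
  [|| [&& (u.1 == size w :> nat), (v.1 == 0%N :> nat) & (u.2 == v.2)]
    | [exists t : 'I_(size w),
        let i := (nth (0%N, true) w t).1 in
        [&& (u.1 == t :> nat), (v.1 == t.+1 :> nat), (u.2 == v.2)
          & S t || ((u.2 != i.-1 :> nat) && (u.2 != i :> nat))]
        || [&& ~~ S t, (u.1 == v.1), ((u.1 == t :> nat) || (u.1 == t.+1 :> nat)),
               (u.2 == i.-1 :> nat) & (v.2 == i :> nat)]]].

Definition state_rel n w S : rel ('I_(size w).+1 * 'I_n) :=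
  fun u v => state_adj S u v || state_adj S v u.

Definition state_loops n w (S : {ffun 'I_(size w) -> bool}) : nat :=
  n_comp (@state_rel n w S) predT.

Definition state_exp (w : bword) (S : {ffun 'I_(size w) -> bool}) : int :=
  \sum_(t < size w) (if (nth (0%N, true) w t).2 == S t then -1 else 1).

Definition bracket (n : nat) (w : bword) : LField :=
  \sum_(S : {ffun 'I_(size w) -> bool})
     Avar ^ state_exp S * loopval ^+ (state_loops n S).-1.

(* writhe: x_i is a negative crossing, x_i^{-1} a positive one, so that the
   closure of x_1^2 in B_2 has V = -s - s^5 (s = A^2). *)
Definition writhe (w : bword) : int :=
  \sum_(l <- w) (if l.2 then -1 else 1).

Definition jones (n : nat) (w : bword) : LField :=
  (- Avar ^+ 3) ^ (- writhe w) * bracket n w.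

Definition word_of (l : seq (nat * int)) : bword :=
  flatten [seq nseq `|p.2|%N (p.1, (0 <= p.2)) | p <- l].

Definition Vseq (n k : nat) (i : 'I_k -> nat) (a : 'I_k -> int) (j : 'I_k)
  (e : int) : LField :=
  jones n (word_of [seq (i h, if h == j then e else a h) | h <- enum 'I_k]).

(* Main.v *)
Require Import Defs.
From mathcomp Require Import all_boot all_order all_algebra all_fingroup.
From mathcomp Require Import fraction zify ring.
Set Implicit Arguments. Unset Strict Implicit. Unset Printing Implicit Defensive.
Import GRing.Theory Num.Theory.

(* Expanding the [e] crossings of the varying block, consecutive cup-caps only
   split off circles, so V(e) = (-s)^e P + s^(3e) Q with s = A^2 and P, Q
   independent of e.

   Each loop configuration of a state can be coherently oriented, hence changing
   one smoothing changes the number of loops by one, and V(e) lies in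
   A^(2 (n - 1 + length)) Z[A^4, A^-4].  Thus V(a) = V(b) = 1 forces b - a to be
   even, say 2 c with c > 0.

   With B = A^(4c), the two equations determine P and Q, and give
   B (B + 1) V(a + 1) = - (A^2 B (B + 1) + A^6 + A^2).  As V(a + 1) is a Laurent
   polynomial over Z, at A = 2 this makes 2^(4c) + 1 divide 17 up to a power
   of 2, so c = 1. *)

(** * Planar diagrams and their loops *)

(* A diagram [d] gives the smoothing at each level: [None] is the identity, and
   [Some i] the cup-cap on positions [i.-1] and [i]. *)
Definition passes (c : option nat) (v : nat) : bool :=
  if c is Some i then (v != i.-1) && (v != i) else true.

(** Coordinates are plain natural numbers, so that a case analysis on the kind of arc involves no
    ordinals. Each arc is listed in one direction only; [diag_rel] symmetrizes. *)
Inductive link (m : nat) (d : nat -> option nat) : nat -> nat -> nat -> nat -> Prop :=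
| Glue v : link m d m v 0 v
| Vert t v : t < m -> passes (d t) v -> link m d t v t.+1 v
| Cup t i : t < m -> d t = Some i -> link m d t i.-1 t i
| Cap t i : t < m -> d t = Some i -> link m d t.+1 i.-1 t.+1 i.

Definition diag_adj m n (d : nat -> option nat) : rel ('I_m.+1 * 'I_n) :=
  fun u v =>
  [|| [&& (u.1 == m :> nat), (v.1 == 0 :> nat) & (u.2 == v.2)]
    | [exists t : 'I_m,
        [&& (u.1 == t :> nat), (v.1 == t.+1 :> nat), (u.2 == v.2) & passes (d t) u.2]
        || (if d t is Some i then
             [&& (u.1 == v.1), ((u.1 == t :> nat) || (u.1 == t.+1 :> nat)),
               (u.2 == i.-1 :> nat) & (v.2 == i :> nat)] else false)]].

Definition diag_rel m n d : rel ('I_m.+1 * 'I_n) :=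
  fun u v => diag_adj d u v || diag_adj d v u.

Definition loops m n (d : nat -> option nat) : nat :=
  n_comp (@diag_rel m n d) predT.

Lemma diag_adjP m n d (u v : 'I_m.+1 * 'I_n) :
  reflect (link m d u.1 u.2 v.1 v.2) (diag_adj d u v).
Proof.
case: u v => [t x] [t' x']; rewrite /diag_adj /=; apply: (iffP idP).
  case/orP => [/and3P[/eqP-> /eqP-> /eqP->]|]; first exact: Glue.
  case/existsP => s /orP[/and4P[/eqP-> /eqP-> /eqP->]|]; first exact: Vert.
  case E: (d s) => [i|] // /and4P[/eqP<- /orP[]/eqP-> /eqP-> /eqP->].
    exact: Cup.
  exact: Cap.
move=> L; move ea: (nat_of_ord t) L => a; move eb: (nat_of_ord x) => b.
move ea': (nat_of_ord t') => a'; move eb': (nat_of_ord x') => b' L.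
case: L ea eb ea' eb' => [y|s y sm ps|s i sm e|s i sm e] ea eb ea' eb'; apply/orP.
- by left; rewrite -val_eqE /= eb eb' !eqxx.
- by right; apply/existsP; exists (Ordinal sm);
    rewrite /= -val_eqE /= eb eb' ps !eqxx.
- by right; apply/existsP; exists (Ordinal sm);
    rewrite /= e -!val_eqE /= ea ea' !eqxx !orbT.
- by right; apply/existsP; exists (Ordinal sm);
    rewrite /= e -!val_eqE /= ea ea' !eqxx !orbT.
Qed.

Lemma diag_relC m n d : connect_sym (@diag_rel m n d).
Proof. by apply: sym_connect_sym => x y; rewrite /diag_rel orbC. Qed.

(** Quantifying over the vertices with given coordinates makes this vacuous out of range; hence
    [conn_trans] asks for a midpoint in range. *)
Definition conn m n d t v t' v' := forall x y : 'I_m.+1 * 'I_n,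
  x.1 = t :> nat -> x.2 = v :> nat -> y.1 = t' :> nat -> y.2 = v' :> nat ->
  connect (diag_rel d) x y.

Lemma conn_link m n d t v t' v' : link m d t v t' v' -> conn m n d t v t' v'.
Proof.
move=> L x y e1 e2 e3 e4; apply/connect1/orP; left; apply/diag_adjP.
by rewrite e1 e2 e3 e4.
Qed.

Lemma conn_sym m n d t v t' v' : conn m n d t v t' v' -> conn m n d t' v' t v.
Proof. by move=> C x y *; rewrite diag_relC; apply: C. Qed.

Lemma conn_refl m n d t v : conn m n d t v t v.
Proof.
move=> [x1 x2] [y1 y2] /= e1 e2 e3 e4.
by rewrite (_ : (x1, x2) = (y1, y2)) //; congr (_, _); apply: val_inj; rewrite /= ?e1 ?e2 ?e3 ?e4.
Qed.

Lemma conn_trans m n d t v t' v' t'' v'' : t' <= m -> v' < n ->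
  conn m n d t v t' v' -> conn m n d t' v' t'' v'' -> conn m n d t v t'' v''.
Proof.
rewrite -ltnS => tm vn C1 C2 x y *.
by apply: (connect_trans (C1 x (Ordinal tm, Ordinal vn) _ _ _ _)) => //; apply: C2.
Qed.

(* Deleting a level: level [p] of the diagram is either an identity, or the same
   cup-cap as the level [p.+1] above it, in which case the arcs between the two
   form the closed loop [cut_loop]. *)
Section DeleteLevel.
Variables (m n p : nat) (d : nat -> option nat).
Hypothesis p_le_m : p <= m.
Hypothesis redundant : d p = None \/ d p = d p.+1 /\ p < m.
Hypothesis dn : forall t i, d t = Some i -> i < n.

Let d' := d \o bump p.

Definition cut_loop : pred ('I_m.+2 * 'I_n) :=
  fun x => (x.1 == p.+1 :> nat) && ~~ passes (d p) x.2.

(** [h] skips level [p.+1], while [g] collapses it onto level [p]. *)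
Let h (x : 'I_m.+1 * 'I_n) : 'I_m.+2 * 'I_n := (lift (inord p.+1) x.1, x.2).
Let g (x : 'I_m.+2 * 'I_n) : 'I_m.+1 * 'I_n := (inord (x.1 - (p < x.1)), x.2).

Let h1 x : (h x).1 = (x.1 + (p < x.1)) :> nat.
Proof. by rewrite /h /= inordK ?ltnS // /bump addnC. Qed.

Let g1 x : (g x).1 = (x.1 - (p < x.1)) :> nat.
Proof. by rewrite /g /= inordK //; have := ltn_ord x.1; lia. Qed.

(** No arc leaves the cut loop: the equal cup-caps at [p] and [p.+1] block the vertical arcs on both
    sides, and [p < m] keeps level [p.+1] away from the glue at level [m.+1]. *)
Lemma cut_loop_link t v t' v' : link m.+1 d t v t' v' ->
  (t == p.+1) && ~~ passes (d p) v = (t' == p.+1) && ~~ passes (d p) v'.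
Proof.
case: redundant => [->|[E lt]]; first by rewrite !andbF.
case=> [w|s w sm ps|s i sm e|s i sm e].
- by have -> : m.+1 == p.+1 = false by lia.
- have [sp|ne] := eqVneq s p; first by rewrite -sp ps !andbF.
  have [sp'|ne'] := eqVneq s p.+1; first by rewrite E -sp' ps !andbF.
  by rewrite eqSS (negPf ne).
- have [sp|//] := eqVneq s p.+1.
  by rewrite E -sp e /= !eqxx /= andbF.
- rewrite eqSS; have [sp|//] := eqVneq s p.
  by rewrite -sp e /= !eqxx /= andbF.
Qed.

Let conn_d' t v t' v' : link m.+1 d t v t' v' ->
  ~~ ((t == p.+1) && ~~ passes (d p) v) ->
  conn m n d' (t - (p < t)) v (t' - (p < t')) v'.
Proof.
have d'lt s : s < p -> d' s = d s by move=> sp; rewrite /d' /= /bump leqNgt sp.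
have d'gt s : p <= s -> d' s = d s.+1 by move=> sp; rewrite /d' /= /bump sp.
case=> [w|s w sm ps|s i sm e|s i sm e] nC.
- by rewrite ltnS p_le_m subn1 sub0n /=; apply/conn_link/Glue.
- case: (ltngtP s p) => sp.
  + have -> : p < s.+1 = false by lia.
    by rewrite !subn0; apply/conn_link/Vert; rewrite ?d'lt //; lia.
  + have -> : p < s.+1 = true by lia.
    rewrite !subn1 /= -{2}(prednK (leq_ltn_trans (leq0n p) sp)).
    by apply/conn_link/Vert; rewrite ?d'gt ?prednK //; lia.
  + by rewrite sp ltnSn subn0 subn1 /=; apply: conn_refl.
- case: (ltngtP s p) => sp.
  + by rewrite !subn0; apply/conn_link/Cup; rewrite ?d'lt //; lia.
  + have s0 : 0 < s by lia.
    rewrite !subn1; apply/conn_link/Cup; rewrite ?d'gt ?prednK //; lia.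
  + rewrite !subn0; apply/conn_link/Cup.
      by case: redundant => [|[_ lt]]; rewrite ?sp // -sp e.
    by case: redundant => [|[E lt]]; rewrite ?sp // -?sp ?e // d'gt ?sp -?E -?sp.
- case: (ltngtP s p) => sp.
  + have -> : p < s.+1 = false by lia.
    by rewrite !subn0; apply/conn_link/Cap; rewrite ?d'lt //; lia.
  + have -> : p < s.+1 = true by lia.
    have s0 : 0 < s by lia.
    rewrite !subn1 /= -(prednK s0).
    by apply/conn_link/Cap; rewrite ?d'gt ?prednK //; lia.
  + by move: nC; rewrite sp eqxx -sp e /= eqxx.
Qed.

Let conn_d t v t' v' : link m d' t v t' v' -> v < n ->
  conn m.+1 n d (t + (p < t)) v (t' + (p < t')) v'.
Proof.
have d'lt s : s < p -> d' s = d s by move=> sp; rewrite /d' /= /bump leqNgt sp.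
have d'gt s : p <= s -> d' s = d s.+1 by move=> sp; rewrite /d' /= /bump sp.
case=> [w|s w sm ps|s i sm e|s i sm e] vn.
- rewrite addn0; case: (ltnP p m) => pm.
    by rewrite addn1; apply/conn_link/Glue.
  (* The deleted level is the last one, so the glue lifts to a vertical arc through it followed by
     the glue. *)
  have {}pm : p = m by lia.
  rewrite addn0; apply: (@conn_trans _ _ _ _ _ m.+1 w) => //.
    apply/conn_link/Vert => //; rewrite -pm.
    by case: redundant => [->//|[_]]; rewrite pm ltnn.
  exact/conn_link/Glue.
- case: (ltngtP s p) => sp.
  + have -> : p < s.+1 = false by lia.
    by rewrite !addn0; apply/conn_link/Vert; rewrite -?d'lt //; lia.
  + have -> : p < s.+1 = true by lia.
    by rewrite !addn1; apply/conn_link/Vert; rewrite -?d'gt //; lia.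
  + rewrite sp ltnSn addn0 addn1; move: ps; rewrite sp d'gt // => ps.
    apply: (@conn_trans _ _ _ _ _ p.+1 w) => //; last first.
      by apply/conn_link/Vert => //; lia.
    apply/conn_link/Vert; first lia.
    by case: redundant => [->//|[-> _]].
- case: (ltngtP s p) => sp.
  + by rewrite !addn0; apply/conn_link/Cup; rewrite -?d'lt //; lia.
  + by rewrite !addn1; apply/conn_link/Cup; rewrite -?d'gt //; lia.
  + rewrite !addn0; move: e; rewrite sp d'gt // => e.
    case: redundant => [E|[E lt]]; last by apply/conn_link/Cup; rewrite ?E //; lia.
    (* Level [p] is the identity here: go across it, along the cup of level [p.+1], and back. *)
    apply: (@conn_trans _ _ _ _ _ p.+1 i.-1) => //.
      by apply/conn_link/Vert; rewrite ?E //; lia.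
    apply: (@conn_trans _ _ _ _ _ p.+1 i); [lia|exact: dn e| |].
      by apply/conn_link/Cup => //; lia.
    by apply/conn_sym/conn_link/Vert; rewrite ?E //; lia.
- case: (ltnP s p) => sp.
  + have -> : p < s.+1 = false by lia.
    by rewrite !addn0; apply/conn_link/Cap; rewrite -?d'lt //; lia.
  + have -> : p < s.+1 = true by lia.
    by rewrite !addn1; apply/conn_link/Cap; rewrite -?d'gt //; lia.
Qed.

Lemma cut_loop_closed : closed (@diag_rel m.+1 n d) (predC cut_loop).
Proof.
move=> x y /orP[] /diag_adjP/cut_loop_link E;
by rewrite !inE /cut_loop E.
Qed.

(** [h] and [g] form an adjunction for connectivity: both send arcs to paths, [g] undoes [h], and
    [h (g x)] is connected to [x] off the cut loop. Hence the components correspond. *)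
Lemma loops_delete_level :
  n_comp (@diag_rel m.+1 n d) (predC cut_loop) = loops m n d'.
Proof.
rewrite (adjunction_n_comp h (@diag_relC _ _ _) (@diag_relC _ _ d') cut_loop_closed).
  apply: eq_n_comp_r => x; rewrite !inE /cut_loop h1.
  by apply/negP => /andP[/eqP]; lia.
apply: (intro_adjunction (@diag_relC _ _ d') cut_loop_closed (fun x _ => g x)).
- move=> x xC; split.
    have hg1 : (h (g x)).1 = (if x.1 == p.+1 :> nat then p else x.1) :> nat.
      rewrite h1 g1; case: eqP => [->|ne]; first by rewrite ltnSn subn1 /= ltnn addn0.
      case: (ltnP p x.1) => px; last by rewrite subn0 ltnNge px addn0.
      rewrite subn1; have -> : p < x.1.-1 by lia.
      by rewrite addn1 (ltn_predK px).
    move: xC; rewrite !inE /cut_loop; case: eqP hg1 => [x1|x1] hg1 /=.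
      rewrite negbK => px; have := @conn_link m.+1 n d p x.2 p.+1 x.2.
      by move=> /(_ (Vert _ px)) C; rewrite diag_relC; apply: C; rewrite ?x1.
    by move=> _; apply: (@conn_refl _ _ d x.1 x.2).
  move=> y yC /orP[] /diag_adjP L.
    by apply: (conn_d' L); rewrite ?g1.
  by rewrite diag_relC; apply: (conn_d' L); rewrite ?g1.
- move=> x _; split.
    by apply: (@conn_refl _ _ _ x.1 x.2); rewrite ?g1 ?h1 //=; lia.
  move=> y /orP[] /diag_adjP L.
    by apply: (conn_d L); rewrite ?h1.
  by rewrite diag_relC; apply: (conn_d L); rewrite ?h1.
Qed.

End DeleteLevel.

Lemma loops_id_level m n p d : p <= m -> (forall t i, d t = Some i -> i < n) ->
  d p = None -> loops m.+1 n d = loops m n (d \o bump p).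
Proof.
move=> pm dn dp; rewrite -loops_delete_level //; last by left.
by apply: eq_n_comp_r => x; rewrite !inE /cut_loop dp andbF.
Qed.

(** The additional loop is [cut_loop], a single component because the cap of level [p] joins its two
    vertices. *)
Lemma loops_cupcap_level m n p d i : p < m ->
  (forall t i, d t = Some i -> i < n) -> d p = Some i -> d p.+1 = Some i ->
  loops m.+1 n d = (loops m n (d \o bump p)).+1.
Proof.
move=> pm dn dp dp1; rewrite -loops_delete_level //; first last.
- by right; rewrite dp dp1.
- exact: ltnW.
have red : d p = None \/ d p = d p.+1 /\ p < m by right; rewrite dp dp1.
have i1n : i.-1 < n by have := dn _ _ dp; lia.
rewrite /loops (n_compC (cut_loop p d)) -[RHS]add1n; congr (_ + _).
pose x0 : 'I_m.+2 * 'I_n := (inord p.+1, Ordinal i1n).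
rewrite -(n_comp_connect (@diag_relC m.+1 n d) x0); apply: eq_n_comp_r => x.
have Cx0 : x0 \in cut_loop p d.
  by rewrite unfold_in /cut_loop /= inordK ?eqxx ?dp /= ?eqxx //; lia.
apply/idP/idP => [/andP[/eqP e1]|C].
  rewrite dp /= negb_and !negbK => /orP[]/eqP e2.
    apply: (@conn_refl _ _ _ p.+1 i.-1) => //=; rewrite inordK //; lia.
  have L : link m.+1 d p.+1 i.-1 p.+1 i by apply: Cap => //; lia.
  by apply: (conn_link L) => //=; rewrite inordK //; lia.
have := closed_connect (cut_loop_closed (ltnW pm) red (n := n)) C.
by rewrite !unfold_in /= => /negb_inj E; suff: cut_loop p d x by []; rewrite -E.
Qed.

(** * Parity of the number of loops *)

(* Orient the strands in even positions upwards and those in odd positions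
   downwards.  Arcs join positions of opposite parity, so every smoothing is
   coherently oriented: its loops are the cycles of the successor permutation
   [successor], and changing one smoothing composes [successor] with a transposition. *)
Section Parity.
Variable n : nat.

Definition valid_diag (d : nat -> option nat) :=
  forall t i, d t = Some i -> 0 < i < n.+1.

(** A move from level [t] towards [t'] across a level with smoothing [c]: a strand that meets an arc
    stays at level [t] and changes position. *)
Definition turn (c : option nat) (t' t v : nat) : nat * nat :=
  if c is Some i then
    if v == i.-1 then (t, i) else if v == i then (t, i.-1) else (t', v)
  else (t', v).

Arguments turn : simpl never.

Definition step m d (up : bool) t v : nat * nat :=
  if up then if t == m then (0, v) else turn (d t) t.+1 t v
  else if t == 0 then (m, v) else turn (d t.-1) t.-1 t v.

Lemma turn_l i t' t : turn (Some i) t' t i.-1 = (t, i).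
Proof. by rewrite /turn eqxx. Qed.

Lemma turn_r i t' t : 0 < i -> turn (Some i) t' t i = (t, i.-1).
Proof. by move=> i0; rewrite /turn eqxx; case: eqP => // ?; lia. Qed.

Lemma turn_pass c t' t v : passes c v -> turn c t' t v = (t', v).
Proof. by case: c => [i|] //= /andP[/negPf h1 /negPf h2]; rewrite /turn h1 h2. Qed.

Lemma turnP c t' t v : (if c is Some i then 0 < i else true) ->
  (exists2 i, c = Some i & v = i.-1 /\ turn c t' t v = (t, i)) \/
  (exists2 i, c = Some i & v = i /\ turn c t' t v = (t, i.-1)) \/
  passes c v /\ turn c t' t v = (t', v).
Proof.
case: c => [i|] i0 /=; last by right; right.
have [->|ne1] := eqVneq v i.-1; first by left; exists i; rewrite ?turn_l.
have [->|ne2] := eqVneq v i; first by right; left; exists i; rewrite ?turn_r.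
by right; right; rewrite turn_pass //= ne1 ne2.
Qed.

Lemma odd_predC i : 0 < i -> odd i.-1 = ~~ odd i.
Proof. by case: i => //= i _; rewrite negbK. Qed.

Variables (m : nat) (d : nat -> option nat).
Hypothesis d_valid : valid_diag d.

Let dP t : if d t is Some i then 0 < i else true.
Proof. by case E: (d t) => [i|] //; case/andP: (d_valid E). Qed.

Lemma step_bound up t v : t <= m -> v < n.+1 ->
  ((step m d up t v).1 <= m) && ((step m d up t v).2 < n.+1).
Proof.
move=> tm vn; rewrite /step; case: up; case: eqP => [_|nt] /=; rewrite ?leqnn ?vn //.
  case: (turnP t.+1 t v (dP t)) => [[i E [_ ->]]|[[i E [_ ->]]|[_ ->]]] /=;
    rewrite ?vn ?andbT ?tm //; try (case/andP: (d_valid E) => ? ?); lia.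
case: (turnP t.-1 t v (dP t.-1)) => [[i E [_ ->]]|[[i E [_ ->]]|[_ ->]]] /=;
    rewrite ?vn ?andbT ?tm //; try (case/andP: (d_valid E) => ? ?); lia.
Qed.

(** Walking back undoes a step: an arc changes the parity of the position and reverses the
    direction, while vertical arcs and the glue keep both. So [odd p.2] is the direction opposite to
    the orientation at the new vertex. *)
Lemma stepK t v : t <= m -> let p := step m d (~~ odd v) t v in
  step m d (odd p.2) p.1 p.2 = (t, v).
Proof.
move=> tm; rewrite /step; case ov: (odd v) => /=.
  have [->|nt] /= := eqVneq t 0; first by rewrite ov eqxx.
  case: (turnP t.-1 t v (dP t.-1)) => [[i E [ev ->]]|[[i E [ev ->]]|[ps ->]]] /=.
  - case/andP: (d_valid E) => i0 _; move: ov; rewrite ev odd_predC // => /negPf->.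
    by rewrite (negPf nt) E turn_r.
  - case/andP: (d_valid E) => i0 _; move: ov; rewrite ev odd_predC // => ->.
    by rewrite (negPf nt) E turn_l.
  - rewrite ov ltn_eqF; last lia.
    by rewrite turn_pass // prednK //; lia.
have [->|nt] /= := eqVneq t m; first by rewrite ov.
case: (turnP t.+1 t v (dP t)) => [[i E [ev ->]]|[[i E [ev ->]]|[ps ->]]] /=.
- case/andP: (d_valid E) => i0 _; move: ov; rewrite ev odd_predC // => /negbFE->.
  by rewrite (negPf nt) E turn_r.
- case/andP: (d_valid E) => i0 _; move: ov; rewrite ev odd_predC // => ->.
  by rewrite (negPf nt) E turn_l.
- by rewrite ov turn_pass.
Qed.

Lemma step_link t v : t <= m -> let p := step m d (~~ odd v) t v in
  link m d t v p.1 p.2 \/ link m d p.1 p.2 t v.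
Proof.
move=> tm; rewrite /step; case: (odd v) => /=.
  case: eqP => [->|nt] /=; first by right; apply: Glue.
  case: t nt tm => // t _ tm; rewrite [t.+1.-1]/=.
  case: (turnP t t.+1 v (dP t)) => [[i E [-> ->]]|[[i E [-> ->]]|[ps ->]]] /=.
  - by left; apply: Cap.
  - by right; apply: Cap.
  - by right; apply: Vert.
case: eqP => [->|nt] /=; first by left; apply: Glue.
have {nt}tm : t < m by lia.
case: (turnP t.+1 t v (dP t)) => [[i E [-> ->]]|[[i E [-> ->]]|[ps ->]]] /=.
- by left; apply: Cup.
- by right; apply: Cup.
- by left; apply: Vert.
Qed.

Lemma link_step t v t' v' : link m d t v t' v' ->
  step m d (~~ odd v) t v = (t', v') \/ step m d (~~ odd v') t' v' = (t, v).
Proof.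
case=> [w|s w sm ps|s i sm e|s i sm e].
- by rewrite /step; case: (odd w) => /=; [right|left]; rewrite ?eqxx.
- rewrite /step; case: (odd w) => /=; [right|left]; first by rewrite turn_pass.
  by rewrite ltn_eqF // turn_pass.
- case/andP: (d_valid e) => i0 _; rewrite /step odd_predC // e (ltn_eqF sm).
  by case: (odd i) => /=; [left|right]; rewrite ?turn_l ?turn_r //.
- case/andP: (d_valid e) => i0 _; rewrite /step odd_predC // [s.+1.-1]/= e.
  by case: (odd i) => /=; [right|left]; rewrite ?turn_l ?turn_r //.
Qed.

Definition successor (x : 'I_m.+1 * 'I_n.+1) : 'I_m.+1 * 'I_n.+1 :=
  let p := step m d (~~ odd x.2) x.1 x.2 in (inord p.1, inord p.2).

Lemma successorE x : ((successor x).1 : nat, (successor x).2 : nat) = step m d (~~ odd x.2) x.1 x.2.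
Proof.
have := step_bound (~~ odd x.2) (ltn_ord x.1) (ltn_ord x.2).
rewrite /successor; case: (step _ _ _ _ _) => a b /= /andP[am bn].
by rewrite !inordK.
Qed.

Lemma successor_inj : injective successor.
Proof.
move=> x y e; have := stepK x.2 (ltn_ord x.1); have := stepK y.2 (ltn_ord y.1).
rewrite -!successorE e /= => -> []; case: x {e} => x1 x2; case: y => y1 y2 /= e1 e2.
by congr (_, _); apply: val_inj.
Qed.

(** Each step follows an arc, and each arc is a step from one of its two ends; as [successor] is
    injective on a finite type, its orbits are symmetric. *)
Lemma successor_connect : fconnect successor =2 connect (@diag_rel m n.+1 d).
Proof.
have sym x y : fconnect successor x y = fconnect successor y x.
  exact: (fconnect_sym successor_inj).
move=> x y; apply/idP/idP; apply: connect_sub => {}x {}y.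
  move=> /eqP <-; apply/connect1; have := step_link x.2 (ltn_ord x.1).
  rewrite -successorE => -[L|L].
    have /diag_adjP H : link m d x.1 x.2 (successor x).1 (successor x).2 := L.
    by rewrite /diag_rel H.
  have /diag_adjP H : link m d (successor x).1 (successor x).2 x.1 x.2 := L.
  by rewrite /diag_rel H orbT.
have eqn (u v : 'I_m.+1 * 'I_n.+1) : step m d (~~ odd u.2) u.1 u.2 = (v.1 : nat, v.2 : nat) ->
    successor u = v.
  rewrite -successorE; case: (successor u) => a b; case: v => a' b' [e1 e2].
  by congr (_, _); apply: val_inj.
by move=> /orP[] /diag_adjP /link_step[] /eqn <-; rewrite 1?sym ?fconnect1 //;
  rewrite sym fconnect1.
Qed.

Lemma loops_porbits : loops m n.+1 d = #|porbits (perm successor_inj)|.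
Proof.
rewrite /loops -(eq_n_comp successor_connect).
have sym : connect_sym (frel successor) by exact: (fconnect_sym successor_inj).
have pE x y : (porbit (perm successor_inj) x == porbit (perm successor_inj) y) = fconnect successor x y.
  rewrite eq_porbit_mem porbit_sym; apply/porbitP/idP => [[k ->]|/iter_findex <-].
    by rewrite permX (eq_iter (permE successor_inj)) fconnect_iter.
  by exists (findex successor x y); rewrite permX (eq_iter (permE successor_inj)).
have pinj : {in froots successor &, injective (porbit (perm successor_inj))}.
  move=> x y /eqP rx /eqP ry /eqP; rewrite pE => /(fingraph.rootP sym).
  by rewrite rx ry.
rewrite /porbits /n_comp_mem.
rewrite [LHS](_ : _ = #|froots successor|); last by apply: eq_card => x; rewrite !inE andbT.
rewrite -(card_in_imset pinj); congr #|pred_of_set _|.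
apply/setP => X; apply/imsetP/imsetP => -[x xr ->]; first by exists x.
exists (froot successor x); first exact: roots_root.
by apply/eqP; rewrite pE connect_root.
Qed.

(** [odd_perm] is defined as the parity of the number of points plus the number of orbits. *)
Lemma odd_loops : odd (loops m n.+1 d) =
  perm successor_inj (+) odd (m.+1 * n.+1).
Proof.
by rewrite loops_porbits /odd_perm card_prod !card_ord addbC addKb.
Qed.
End Parity.

Lemma odd_loops_smooth m n d i : valid_diag n d -> d 0 = Some i ->
  odd (loops m.+1 n.+1 d) =
  ~~ odd (loops m.+1 n.+1 (fun t => if t is 0 then None else d t)).
Proof.
move=> dv d0; pose d' t := if t is 0 then None else d t.
have d'v : valid_diag n d' by case=> [|t] j //= /dv.
case/andP: (dv _ _ d0) => i0 iN.
pose e := if odd i then i.-1 else i; pose o := if odd i then i else i.-1.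
have eN : e < n.+1 by rewrite /e; case: ifP; lia.
have oN : o < n.+1 by rewrite /o; case: ifP; lia.
have oe : odd e = false by rewrite /e; case: ifP; rewrite ?odd_predC // => ->.
have oo : odd o by rewrite /o; case: ifP; rewrite ?odd_predC // => ->.
have te t' t : turn (d 0) t' t e = (t, o).
  by rewrite d0 /e /o; case: ifP; rewrite ?turn_l ?turn_r.
have to t' t : turn (d 0) t' t o = (t, e).
  by rewrite d0 /e /o; case: ifP; rewrite ?turn_l ?turn_r.
have pe v : odd v = false -> v != e -> passes (d 0) v.
  move=> ov ve; rewrite d0 /=; apply/andP; split; apply/eqP => vi.
    by move: ov ve; rewrite vi odd_predC // /e => /negbFE->; rewrite eqxx.
  by move: ov ve; rewrite vi /e => ->; rewrite eqxx.
have po v : odd v -> v != o -> passes (d 0) v.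
  move=> ov ve; rewrite d0 /=; apply/andP; split; apply/eqP => vi.
    by move: ov ve; rewrite vi odd_predC // /o => /negPf->; rewrite eqxx.
  by move: ov ve; rewrite vi /o => ->; rewrite eqxx.
rewrite [in RHS](odd_loops m.+1 d'v) [LHS](odd_loops m.+1 dv).
(* [x] and [y] are the vertices at which the orientation enters the two arcs of the cup-cap: the
   even position [e] from below, the odd position [o] from above. Removing the cup-cap exchanges
   their successors and changes nothing else. *)
pose x : 'I_m.+2 * 'I_n.+1 := (inord 0, inord e).
pose y : 'I_m.+2 * 'I_n.+1 := (inord 1, inord o).
suff -> : perm (successor_inj (m := m.+1) dv) = (tperm x y * perm (successor_inj (m := m.+1) d'v))%g.
  rewrite odd_permM odd_tperm; have -> : x != y.
    by apply/eqP => -[] /(congr1 val); rewrite /= !inordK.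
  by rewrite addTb addNb.
apply/permP => z; rewrite permM [LHS]permE [RHS]permE.
have successorC (u v : 'I_m.+2 * 'I_n.+1) :
    step m.+1 d (~~ odd u.2) u.1 u.2 = step m.+1 d' (~~ odd v.2) v.1 v.2 ->
    successor d u = successor d' v by rewrite /successor => ->.
case: tpermP => [->|->|/eqP zx /eqP zy]; apply: successorC.
- by rewrite /= !inordK // oo oe /step /= te.
- by rewrite /= !inordK // oo oe /step /= to.
case: z zx zy => t v /= zx zy; rewrite /step.
have tx : t = 0 :> nat -> v != e :> nat.
  move=> t0; apply: contraNneq zx => ve; apply/eqP; congr (_, _);
    by apply: val_inj; rewrite /= inordK.
have ty : t = 1 :> nat -> v != o :> nat.
  move=> t0; apply: contraNneq zy => ve; apply/eqP; congr (_, _);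
    by apply: val_inj; rewrite /= inordK.
move: (nat_of_ord t) (nat_of_ord v) tx ty => {zx zy}{}t {}v tx ty.
case: t tx ty => [|[|t]] tx ty; case ov: (odd v) => //=.
- by rewrite turn_pass ?pe ?tx.
- by rewrite turn_pass ?po ?ty.
Qed.

Lemma loops0 n d : loops 0 n.+1 d = n.+1.
Proof.
rewrite /loops (@eq_n_comp _ _ (frel id)); last first.
  apply: eq_connect => u v; apply/idP/eqP => [|->].
    have z (w : 'I_1) : w = 0 :> nat by case: w => [[]].
    case: u v => a b [a' b']; move=> /orP[] /diag_adjP L; congr (_, _); apply: val_inj; rewrite /= ?z //;
    by move: L => /=; rewrite !z => L; inversion L.
  by apply/orP; left; apply/diag_adjP; case: v => -[[|//] ?] v /=; apply: Glue.
by rewrite fcard_id card_prod !card_ord mul1n.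
Qed.

(** Induction on the levels: a cup-cap at level 0 is traded for an identity at the cost of one
    parity change, and the identity level is then deleted. *)
Lemma loops_parity m n d : valid_diag n d ->
  odd (loops m n.+1 d) = odd n.+1 (+) odd (\sum_(t < m) isSome (d t)).
Proof.
elim: m d => [|m IH] d dv; first by rewrite loops0 big_ord0 addbF.
have dlt (f : nat -> option nat) : valid_diag n f -> forall t i, f t = Some i -> i < n.+1.
  by move=> fv t i /fv /andP[].
have shift (f : nat -> option nat) : valid_diag n f -> f 0 = None ->
    loops m.+1 n.+1 f = loops m n.+1 (fun t => f t.+1).
  by move=> fv f0; rewrite (loops_id_level (p := 0)) //; apply: dlt.
have d'v : valid_diag n (fun t => if t is 0 then None else d t).
  by case=> [|t] j //= /dv.
rewrite big_ord_recl /= oddD addbCA; case E: (d 0) => [i|] /=.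
  by rewrite (odd_loops_smooth m dv E) shift // IH // => t j /dv.
by rewrite shift // IH // => t j /dv.
Qed.

Lemma eq_loops m n d d' : (forall t, t < m -> d t = d' t) ->
  loops m n d = loops m n d'.
Proof.
move=> dd; apply: eq_n_comp; apply: eq_connect => u v.
suff E x y : @diag_adj m n d x y = diag_adj d' x y by rewrite /diag_rel !E.
by rewrite /diag_adj; congr (_ || _); apply: eq_existsb => t; rewrite dd.
Qed.

Lemma loops_gt0 m n d : 0 < loops m n.+1 d.
Proof.
rewrite /loops; pose x0 : 'I_m.+1 * 'I_n.+1 := (ord0, ord0).
apply/card_gt0P; exists (fingraph.root (diag_rel d) x0).
by rewrite inE /= fingraph.roots_root //; apply: diag_relC.
Qed.

(** * The state sum of a braid word *)

Definition diag_loops n (c : seq (option nat)) := loops (size c) n (nth None c).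

Definition valid_seq n (c : seq (option nat)) :=
  all (fun o => if o is Some i then 0 < i < n.+1 else true) c.

Lemma valid_seqP n c : valid_seq n c -> valid_diag n (nth None c).
Proof.
move=> /allP cv t i e; have := cv (nth None c t).
by case: (ltnP t (size c)) => [tc /(_ (mem_nth _ tc))|ct]; [rewrite e | rewrite nth_default // in e].
Qed.

Lemma nth_cat_bump (c1 c2 : seq (option nat)) o t :
  nth None (c1 ++ o :: c2) (bump (size c1) t) = nth None (c1 ++ c2) t.
Proof.
rewrite !nth_cat /bump; case: (ltnP t (size c1)) => tc /=; first by rewrite add0n tc.
by rewrite add1n ltnNge leqW //= subSn.
Qed.

Lemma diag_loops_id n c1 c2 : valid_seq n (c1 ++ None :: c2) ->
  diag_loops n.+1 (c1 ++ None :: c2) = diag_loops n.+1 (c1 ++ c2).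
Proof.
move=> /valid_seqP cv; rewrite /diag_loops.
have -> : size (c1 ++ None :: c2) = (size (c1 ++ c2)).+1 by rewrite !size_cat addnS.
rewrite (@loops_id_level _ _ (size c1)).
- by apply: eq_loops => t _; apply: nth_cat_bump.
- by rewrite size_cat leq_addr.
- by move=> t i /cv /andP[].
- by rewrite nth_cat ltnn subnn.
Qed.

Lemma diag_loops_cupcap n c1 c2 i : valid_seq n (c1 ++ Some i :: Some i :: c2) ->
  diag_loops n.+1 (c1 ++ Some i :: Some i :: c2) = (diag_loops n.+1 (c1 ++ Some i :: c2)).+1.
Proof.
move=> /valid_seqP cv; rewrite /diag_loops.
have -> : size (c1 ++ Some i :: Some i :: c2) = (size (c1 ++ Some i :: c2)).+1.
  by rewrite !size_cat !addnS.
rewrite (@loops_cupcap_level _ _ (size c1) _ i).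
- by apply: (congr1 S); apply: eq_loops => t _; apply: nth_cat_bump.
- by rewrite size_cat /= addnS ltnS leq_addr.
- by move=> t j /cv /andP[].
- by rewrite nth_cat ltnn subnn.
- by rewrite nth_cat ltnNge leqnSn subSnn.
Qed.

(** After a first cup-cap, each identity can be deleted and each further cup-cap splits off one
    circle. *)
Lemma diag_loops_block1 n c1 c2 i s : 0 < i < n.+1 -> valid_seq n c1 -> valid_seq n c2 ->
  diag_loops n.+1 (c1 ++ Some i :: [seq (if b then None else Some i) | b : bool <- s] ++ c2)
  = diag_loops n.+1 (c1 ++ Some i :: c2) + count negb s.
Proof.
move=> iv v1 v2.
have vs s' : valid_seq n ([seq (if b then None else Some i) | b : bool <- s'] ++ c2).
  by rewrite /valid_seq all_cat [all _ c2]v2 andbT all_map; apply/allP => -[].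
elim: s => [|[] s IH] /=; first by rewrite addn0.
- rewrite -cat_rcons diag_loops_id ?cat_rcons ?IH //.
  by rewrite /valid_seq all_cat [all _ c1]v1 /= iv; apply: vs.
- rewrite diag_loops_cupcap ?IH ?addnS //.
  by rewrite /valid_seq all_cat [all _ c1]v1 /= iv; apply: vs.
Qed.

Lemma diag_loops_block n c1 c2 i s : 0 < i < n.+1 -> valid_seq n c1 -> valid_seq n c2 ->
  diag_loops n.+1 (c1 ++ [seq (if b then None else Some i) | b : bool <- s] ++ c2)
  = if count negb s is k.+1 then diag_loops n.+1 (c1 ++ Some i :: c2) + k
    else diag_loops n.+1 (c1 ++ c2).
Proof.
move=> iv v1 v2; elim: s => [|[] s IH] //=; last by rewrite diag_loops_block1.
rewrite diag_loops_id //.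
rewrite /valid_seq all_cat [all _ c1]v1 /= all_cat [all _ c2]v2 all_map andbT.
by apply/allP => -[].
Qed.

Local Open Scope ring_scope.

(** States are Boolean sequences here instead of finite functions, so that the sum over the states
    of a concatenated word splits into nested sums. *)
Fixpoint state_sum (V : nmodType) m (F : seq bool -> V) : V :=
  if m is m'.+1 then
    state_sum m' (fun s => F (true :: s)) + state_sum m' (fun s => F (false :: s))
  else F [::].

Lemma eq_state_sum (V : nmodType) m (F F' : seq bool -> V) :
  (forall s, size s = m -> F s = F' s) -> state_sum m F = state_sum m F'.
Proof.
elim: m F F' => [|m IH] F F' e /=; first exact: e.
by congr (_ + _); apply: IH => s sm; apply: e; rewrite /= sm.
Qed.

Lemma state_sum_cat (V : nmodType) m1 m2 (F : seq bool -> V) :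
  state_sum (m1 + m2) F = state_sum m1 (fun s => state_sum m2 (fun t => F (s ++ t))).
Proof. by elim: m1 F => //= m1 IH F; rewrite !IH. Qed.

Lemma state_sumD (V : nmodType) m (F G : seq bool -> V) :
  state_sum m (fun s => F s + G s) = state_sum m F + state_sum m G.
Proof. by elim: m F G => //= m IH F G; rewrite !IH addrACA. Qed.

Lemma state_sumMl (R : pzSemiRingType) m (F : seq bool -> R) x :
  state_sum m (fun s => x * F s) = x * state_sum m F.
Proof. by elim: m F => //= m IH F; rewrite !IH mulrDr. Qed.

Lemma sum_ffun_bool (V : nmodType) m (G : {ffun 'I_m -> bool} -> V) :
  \sum_S G S = state_sum m (fun s => G [ffun t : 'I_m => nth true s t]).
Proof.
elim: m G => [|m IH] G /=.
  rewrite (big_pred1 [ffun t : 'I_0 => nth true [::] t]) // => S.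
  by apply/esym/eqP/ffunP => -[].
pose consf (p : bool * {ffun 'I_m -> bool}) : {ffun 'I_m.+1 -> bool} :=
  [ffun t => if unlift ord0 t is Some t' then p.2 t' else p.1].
rewrite (reindex consf) /=; last first.
  exists (fun f : {ffun 'I_m.+1 -> bool} => (f ord0, [ffun t => f (lift ord0 t)])).
    move=> [b f] _; rewrite /consf ffunE unlift_none /=; congr (_, _).
    by apply/ffunP => t; rewrite !ffunE liftK.
  move=> f _; apply/ffunP => t; rewrite ffunE /=.
  by case: unliftP => [t' ->|->] //; rewrite ffunE.
rewrite -(pair_bigA _ (fun b f => G (consf (b, f)))) /= big_bool /= !IH.
congr (_ + _); apply: eq_state_sum => s _; congr G; apply/ffunP => t;
  rewrite !ffunE; by case: unliftP => [t' ->|->] //=; rewrite ffunE.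
Qed.

Definition smoothing (w : bword) (s : seq bool) : seq (option nat) :=
  [seq (if p.2 then None else Some p.1.1) | p <- zip w s].

Definition smoothing_exp (w : bword) (s : seq bool) : int :=
  \sum_(p <- zip w s) (if p.1.2 == p.2 then -1 else 1).

Definition state_weight n w s : LField :=
  Avar ^ smoothing_exp w s * loopval ^+ (diag_loops n (smoothing w s)).-1.

Lemma bracketE n w : bracket n w = state_sum (size w) (state_weight n w).
Proof.
rewrite /bracket sum_ffun_bool; apply: eq_state_sum => s ss.
congr (_ ^ _ * _ ^+ _.-1).
  rewrite /state_exp /smoothing_exp [RHS](big_nth ((0%N, true), true)) size1_zip ?ss // big_mkord.
  by apply: eq_bigr => t _; rewrite ffunE nth_zip.
rewrite /state_loops /diag_loops size_map (size1_zip (eq_leq (esym ss))).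
apply: eq_n_comp; apply: eq_connect => u v.
set d := nth None _.
have dE (t : 'I_(size w)) : d t = if nth true s t then None else Some (nth (0%N, true) w t).1.
  by rewrite /d (nth_map ((0%N, true), true)) ?size1_zip ?ss // nth_zip.
suff E x y : state_adj [ffun t : 'I_(size w) => nth true s t] x y = diag_adj (n := n) d x y.
  by rewrite /state_rel /diag_rel !E.
rewrite /state_adj /diag_adj; congr (_ || _); apply: eq_existsb => t.
by rewrite dE ffunE; case: (nth true s t).
Qed.

(** * Expansion of a block of equal crossings *)

Lemma Avar_neq0 : Avar != 0.
Proof. by rewrite tofrac_eq0 polyX_eq0. Qed.

Lemma AvarXn k : Avar ^+ k = FracField.tofrac 'X^k.
Proof. by rewrite tofracXn. Qed.

Lemma tofrac_neq0 (p : {poly int}) x : p.[x] != 0 -> FracField.tofrac p != 0.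
Proof. by rewrite tofrac_eq0; apply: contra_neq => ->; rewrite horner0. Qed.

Lemma loop_expr (F : fieldType) (A : F) : A != 0 ->
  - A ^+ 2 - A ^- 2 = - (A ^+ 4 + 1) / A ^+ 2.
Proof. by move=> A0; field. Qed.

Lemma block_step (F : fieldType) (a D x y am bm : F) : a != 0 -> D != 0 ->
  a * (am * (x - y / D) + bm * (y / D)) + a^-1 * y * bm
  = a * am * (x - y / D) + (a + a^-1 * D) * bm * (y / D).
Proof. by move=> a0 D0; field; rewrite ?a0 ?D0. Qed.

Lemma loopval_neq0 : loopval != 0.
Proof.
have -> : loopval = - (Avar ^+ 4 + 1) / Avar ^+ 2 := loop_expr Avar_neq0.
apply: mulf_neq0; last by rewrite invr_eq0 expf_neq0 ?Avar_neq0.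
(* The numerator [X^4 + 1] takes the value 1 at 0. *)
rewrite oppr_eq0 AvarXn -[1]tofrac1 -tofracD; apply: (tofrac_neq0 (x := 0)).
by rewrite !hornerE.
Qed.

Lemma state_sum_exchange (V : nmodType) m1 m2 (F : seq bool -> seq bool -> V) :
  state_sum m1 (fun s => state_sum m2 (F s)) =
  state_sum m2 (fun t => state_sum m1 (fun s => F s t)).
Proof.
elim: m1 F => //= m1 IH F; rewrite !IH -state_sumD.
by apply: eq_state_sum.
Qed.

Lemma smoothing_cat w1 w2 s1 s2 : size s1 = size w1 ->
  smoothing (w1 ++ w2) (s1 ++ s2) = smoothing w1 s1 ++ smoothing w2 s2.
Proof. by move=> e; rewrite /smoothing zip_cat // map_cat. Qed.

Lemma smoothing_exp_cat w1 w2 s1 s2 : size s1 = size w1 ->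
  smoothing_exp (w1 ++ w2) (s1 ++ s2) = smoothing_exp w1 s1 + smoothing_exp w2 s2.
Proof. by move=> e; rewrite /smoothing_exp zip_cat // big_cat. Qed.

Lemma smoothing_exp_cons l w b s :
  smoothing_exp (l :: w) (b :: s) = (if l.2 == b then -1 else 1) + smoothing_exp w s.
Proof. by rewrite /smoothing_exp /= big_cons. Qed.

Lemma smoothing_nseq i b s :
  smoothing (nseq (size s) (i, b)) s = [seq (if b then None else Some i) | b : bool <- s].
Proof. by elim: s => //= c s; rewrite /smoothing /= => ->. Qed.

Definition valid_word n (w : bword) := all (fun l => 0 < l.1 < n.+1)%N w.

Lemma valid_smoothing n w s : valid_word n w -> valid_seq n (smoothing w s).
Proof.
elim: w s => [|l w IH] [|b s] //= /andP[lv wv].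
by rewrite /valid_seq /= [all _ _]IH // andbT; case: b.
Qed.

Definition smooth_id_weight (b : bool) : LField := if b then Avar^-1 else Avar.

Lemma smooth_id_weightE b : Avar ^ (if b == true then -1 else 1 : int) = smooth_id_weight b.
Proof. by case: b; rewrite /= ?expr1z. Qed.

Lemma smooth_cup_weightE b : Avar ^ (if b == false then -1 else 1 : int) = (smooth_id_weight b)^-1.
Proof. by case: b; rewrite /smooth_id_weight ?invrK ?expr1z. Qed.

(** The weight is multiplicative over the crossings, so the sum factors. *)
Lemma block_sum_geom m i b :
  state_sum m (fun t => Avar ^ smoothing_exp (nseq m (i, b)) t * loopval ^+ count negb t)
  = (smooth_id_weight b + (smooth_id_weight b)^-1 * loopval) ^+ m.
Proof.
elim: m => [|m IH] /=; first by rewrite /smoothing_exp big_nil mulr1.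
rewrite exprS mulrDl -IH -!state_sumMl; congr (_ + _); apply: eq_state_sum => s _.
  by rewrite smoothing_exp_cons add0n (expfzDr _ _ Avar_neq0) smooth_id_weightE -mulrA.
rewrite smoothing_exp_cons add1n exprS (expfzDr _ _ Avar_neq0) smooth_cup_weightE -!mulrA.
by congr (_ * _); rewrite mulrCA.
Qed.

(** [W k] is the value of a block with [k] cup-caps. It is geometric, equal to
    [y / loopval * loopval ^+ k], except at [k = 0]; the correction [W 0 - y / loopval] is met only
    by the all-identity state. *)
Lemma block_sum m i b (W : nat -> LField) y : (forall k, W k.+1 = y * loopval ^+ k) ->
  state_sum m (fun t => Avar ^ smoothing_exp (nseq m (i, b)) t * W (count negb t))
  = smooth_id_weight b ^+ m * (W 0%N - y / loopval)
    + (smooth_id_weight b + (smooth_id_weight b)^-1 * loopval) ^+ m * (y / loopval).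
Proof.
move=> Wk.
have a0 : smooth_id_weight b != 0.
  by rewrite -smooth_id_weightE expfz_neq0 ?Avar_neq0.
elim: m => [|m IH].
  by rewrite /= /smoothing_exp big_nil !expr0 !mul1r subrK.
have stepT : state_sum m (fun t => Avar ^ smoothing_exp (nseq m.+1 (i, b)) (true :: t)
    * W (count negb (true :: t))) =
    smooth_id_weight b * state_sum m (fun t => Avar ^ smoothing_exp (nseq m (i, b)) t * W (count negb t)).
  rewrite -state_sumMl; apply: eq_state_sum => s _.
  by rewrite smoothing_exp_cons (expfzDr _ _ Avar_neq0) smooth_id_weightE -mulrA.
(* A cup-cap at the first crossing puts all counts in the geometric range. *)
have stepF : state_sum m (fun t => Avar ^ smoothing_exp (nseq m.+1 (i, b)) (false :: t)
    * W (count negb (false :: t))) =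
    (smooth_id_weight b)^-1 * y * state_sum m (fun t =>
      Avar ^ smoothing_exp (nseq m (i, b)) t * loopval ^+ (count negb t)).
  rewrite -state_sumMl; apply: eq_state_sum => s _.
  rewrite smoothing_exp_cons [count _ _]add1n Wk (expfzDr _ _ Avar_neq0) smooth_cup_weightE.
  by rewrite -!mulrA; congr (_ * _); rewrite mulrCA.
transitivity (
    smooth_id_weight b * state_sum m (fun t =>
      Avar ^ smoothing_exp (nseq m (i, b)) t * W (count negb t))
    + (smooth_id_weight b)^-1 * y * state_sum m (fun t =>
      Avar ^ smoothing_exp (nseq m (i, b)) t * loopval ^+ (count negb t))).
  by rewrite -stepT -stepF.
by rewrite IH block_sum_geom (block_step _ _ _ _ a0 loopval_neq0) -!exprS.
Qed.

Lemma bracket_block n w1 w2 i :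
  valid_word n w1 -> valid_word n w2 -> (0 < i < n.+1)%N ->
  exists X Y : LField, forall m b, bracket n.+1 (w1 ++ nseq m (i, b) ++ w2) =
    smooth_id_weight b ^+ m * X
    + (smooth_id_weight b + (smooth_id_weight b)^-1 * loopval) ^+ m * Y.
Proof.
move=> v1 v2 iv.
pose outer s u := Avar ^ (smoothing_exp w1 s + smoothing_exp w2 u).
pose loops_id s u := diag_loops n.+1 (smoothing w1 s ++ smoothing w2 u).
pose loops_cup s u := diag_loops n.+1 (smoothing w1 s ++ Some i :: smoothing w2 u).
pose y s u := loopval ^+ (loops_cup s u).-1.
pose W s u k := if k is k'.+1 then y s u * loopval ^+ k' else loopval ^+ (loops_id s u).-1.
pose sum2 F := state_sum (size w1) (fun s => state_sum (size w2) (fun u => outer s u * F s u)).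
exists (sum2 (fun s u => W s u 0%N - y s u / loopval)), (sum2 (fun s u => y s u / loopval)) => m b.
(* The sum over the block is moved innermost, where [block_sum] applies for each fixed pair of outer
   states [s] and [u]. *)
transitivity (sum2 (fun s u =>
    state_sum m (fun t => Avar ^ smoothing_exp (nseq m (i, b)) t * W s u (count negb t)))).
  rewrite bracketE !size_cat size_nseq state_sum_cat; apply: eq_state_sum => s ss.
  rewrite state_sum_cat state_sum_exchange; apply: eq_state_sum => u su.
  rewrite -state_sumMl; apply: eq_state_sum => t st.
  rewrite /state_weight !smoothing_exp_cat ?size_nseq //.
  rewrite !smoothing_cat ?size_nseq // -st smoothing_nseq.
  rewrite diag_loops_block // ?valid_smoothing //.
  rewrite [_ + _ in LHS]addrCA addrC (expfzDr _ _ Avar_neq0) -mulrA; congr (_ * (_ * _)).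
  case: (count negb t) => [|k] //=; rewrite /y -exprD; congr (_ ^+ _).
  by rewrite /loops_cup /diag_loops -[loops _ _ _](prednK (loops_gt0 _ _ _)).
rewrite /sum2 -!state_sumMl -state_sumD; apply: eq_state_sum => s _.
rewrite -!state_sumMl -state_sumD; apply: eq_state_sum => u _.
rewrite (@block_sum _ _ _ _ (y s u)) // mulrDr; congr (_ + _); exact: mulrCA.
Qed.

Lemma writhe_cat w1 w2 : writhe (w1 ++ w2) = writhe w1 + writhe w2.
Proof. by rewrite /writhe big_cat. Qed.

Lemma writhe_nseq i (e : int) : writhe (nseq `|e|%N (i, 0 <= e)) = - e.
Proof.
have E m b : writhe (nseq m (i, b)) = (if b then - m%:Z else m%:Z).
  elim: m => [|m IH] /=; rewrite /writhe ?big_nil ?big_cons; first by case: b.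
  by move: IH; rewrite /writhe => ->; case: b => /=; lia.
by rewrite E; case: e => k /=; lia.
Qed.

Lemma smooth_cup_true (F : fieldType) (A : F) : A != 0 ->
  A^-1 + A^-1^-1 * (- A ^+ 2 - A ^- 2) = - A ^+ 3.
Proof. by move=> A0; rewrite invrK; field. Qed.

Lemma smooth_cup_false (F : fieldType) (A : F) : A != 0 ->
  A + A^-1 * (- A ^+ 2 - A ^- 2) = (- A ^+ 3)^-1.
Proof. by move=> A0; field; rewrite ?oppr_eq0 ?expf_neq0. Qed.

(** The block contributes [- e] to the writhe, and [w] is the writhe of the rest; the twist factor
    turns the ratios [A^-1] and [- A^3] into [- A^2] and [A^6]. *)
Lemma twist_exprz (F : fieldType) (A X Y : F) (w e : int) : A != 0 ->
  (- A ^+ 3) ^ (- (w - e)) * (A ^ (- e) * X + (- A ^+ 3) ^ e * Y) =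
  (- A ^+ 2) ^ e * ((- A ^+ 3) ^ (- w) * X) + (A ^+ 6) ^ e * ((- A ^+ 3) ^ (- w) * Y).
Proof.
move=> A0; have A3 : - A ^+ 3 != 0 by rewrite oppr_eq0 expf_neq0.
have -> : - (w - e) = - w + e by rewrite opprB addrC.
rewrite expfzDr // mulrDr; congr (_ + _).
  have -> : - A ^+ 2 = - A ^+ 3 * A^-1 by field.
  by rewrite exprzMl ?unitfE ?invr_eq0 // exprz_inv; ring.
have -> : A ^+ 6 = - A ^+ 3 * - A ^+ 3 by ring.
by rewrite exprzMl ?unitfE //; ring.
Qed.

(** One formula covers both signs of [e], since replacing a generator by its inverse inverts the
    identity weight as well as the total [- A^3]. *)
Lemma jones_block n w1 w2 i :
  valid_word n w1 -> valid_word n w2 -> (0 < i < n.+1)%N ->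
  exists P Q : LField, forall e : int,
    jones n.+1 (w1 ++ nseq `|e|%N (i, 0 <= e) ++ w2) =
      (- Avar ^+ 2) ^ e * P + (Avar ^+ 6) ^ e * Q.
Proof.
move=> v1 v2 iv; have [X [Y XY]] := bracket_block v1 v2 iv.
pose w := writhe w1 + writhe w2.
exists ((- Avar ^+ 3) ^ (- w) * X), ((- Avar ^+ 3) ^ (- w) * Y) => e.
rewrite -(twist_exprz _ _ _ _ Avar_neq0) /jones !writhe_cat writhe_nseq XY.
congr (_ ^ (- _) * (_ * _ + _ * _)); first by rewrite /w; lia.
  case: e => k; first by rewrite [LHS]exprVn exprnN.
  by rewrite NegzE opprK.
case: e => k.
  by rewrite lez_nat /smooth_id_weight (smooth_cup_true Avar_neq0).
have -> : (0 <= Negz k) = false by [].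
by rewrite /smooth_id_weight (smooth_cup_false Avar_neq0) exprVn.
Qed.

(** * The grading by powers of [A] *)

(* Membership in [A ^ z * Z[A ^ 4, A ^ -4]]. *)
Definition graded (z : int) (x : LField) := exists (N : nat) (p : {poly int}),
  x * Avar ^ ((4 * N)%:Z - z) = FracField.tofrac (p \Po 'X^4).

Lemma AvarD z1 z2 : Avar ^ (z1 + z2) = Avar ^ z1 * Avar ^ z2.
Proof. exact: (expfzDr _ _ Avar_neq0). Qed.

(** Multiplying by [A^(4 M)] enlarges the cleared denominator, which allows common denominators and
    nonnegative exponents. *)
Lemma graded_large z x M : graded z x -> exists (N : nat) (p : {poly int}),
  (M <= N)%N /\ x * Avar ^ ((4 * N)%:Z - z) = FracField.tofrac (p \Po 'X^4).
Proof.
move=> [N [p e]]; exists (N + M)%N, (p * 'X^M); split; first exact: leq_addl.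
rewrite comp_polyM tofracM -e comp_Xn_poly -exprM -AvarXn -mulrA; congr (_ * _).
by rewrite [Avar ^+ _]exprnP -AvarD; congr (_ ^ _); lia.
Qed.

Lemma gradedM z1 z2 x1 x2 : graded z1 x1 -> graded z2 x2 -> graded (z1 + z2) (x1 * x2).
Proof.
move=> [N1 [p1 e1]] [N2 [p2 e2]]; exists (N1 + N2)%N, (p1 * p2).
rewrite comp_polyM tofracM -e1 -e2 mulrACA -AvarD; congr (_ * _ ^ _); lia.
Qed.

Lemma gradedD z x1 x2 : graded z x1 -> graded z x2 -> graded z (x1 + x2).
Proof.
move=> g1 [N2 [p2 e2]].
have [N1 [p1 [le12 e1]]] := graded_large N2 g1.
exists N1, (p1 + p2 * 'X^(N1 - N2)).
rewrite comp_polyD comp_polyM tofracD tofracM -e1 -e2 comp_Xn_poly -exprM -AvarXn mulrDl.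
congr (_ + _); rewrite -mulrA; congr (_ * _).
by rewrite [Avar ^+ _]exprnP -AvarD; congr (_ ^ _); lia.
Qed.

Lemma gradedN z x : graded z x -> graded z (- x).
Proof. by move=> [N [p e]]; exists N, (- p); rewrite mulNr e -tofracN [(- p) \Po _]raddfN. Qed.

Lemma graded_mod z z' k x : graded z x -> z' = z + 4 * k -> graded z' x.
Proof.
move=> g ->; have [N [p [le e]]] := graded_large `|k|%N g.
exists (absz (N%:Z + k)), p; rewrite -e; congr (_ * _ ^ _); lia.
Qed.

Lemma graded_Avar z : graded z (Avar ^ z).
Proof. by exists 0%N, 1; rewrite -AvarD comp_polyC tofrac1 subrKC. Qed.

Lemma graded0 : graded 0 1.
Proof. exact: (graded_Avar 0). Qed.

Lemma gradedX z x k : graded z x -> graded (z * k%:Z) (x ^+ k).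
Proof.
move=> g; elim: k => [|k IH]; first by rewrite mulr0 expr0; apply: graded0.
by rewrite exprS intS mulrDr mulr1; apply: gradedM.
Qed.

Lemma graded_loopval : graded 2 loopval.
Proof.
apply: gradedD; apply: gradedN; first exact: (graded_Avar 2).
by apply: (@graded_mod (- 2) _ 1) => //; have := graded_Avar (- 2).
Qed.

Lemma expNX3z (F : fieldType) (A : F) z : A != 0 ->
  (- A ^+ 3) ^ z = A ^ (3 * z) \/ (- A ^+ 3) ^ z = - A ^ (3 * z).
Proof.
move=> A0; have -> : (- A ^+ 3) ^ z = (-1) ^ z * A ^ (3 * z).
  rewrite -[- A ^+ 3]mulN1r exprzMl ?unitfE ?expf_neq0 ?oppr_eq0 ?oner_eq0 //.
  by rewrite [A ^+ 3]exprnP exprz_exp.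
have [->|->] : (-1 : F) ^ z = 1 \/ (-1 : F) ^ z = - 1; last 2 first.
- by left; rewrite mul1r.
- by right; rewrite mulN1r.
case: z => k; first by rewrite -exprnP -signr_odd; case: odd; [right|left].
by rewrite NegzE -exprnN -signr_odd; case: odd; [right|left]; rewrite ?expr1 ?invrN1 ?invr1.
Qed.

Lemma graded_twist z : graded (3 * z) ((- Avar ^+ 3) ^ z).
Proof.
have [->|->] := expNX3z z Avar_neq0; last apply: gradedN; exact: graded_Avar.
Qed.

Lemma graded_state_sum z m F :
  (forall s, size s = m -> graded z (F s)) -> graded z (state_sum m F).
Proof.
elim: m F => [|m IH] F g /=; first exact: g.
by apply: gradedD; apply: IH => s sm; apply: g; rewrite /= sm.
Qed.

Lemma writhe_parity w : exists k : int, writhe w = (size w)%:Z + 2 * k.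
Proof.
elim: w => [|l w [k IH]]; first by exists 0; rewrite /writhe big_nil.
rewrite /writhe big_cons -/(writhe w) IH /=; case: l.2.
  by exists (k - 1); lia.
by exists k; lia.
Qed.

(** The all-identity state has exponent [writhe w], and each cup-cap changes it by 2 or -2, which
    agree modulo 4. *)
Lemma smoothing_exp_mod4 w s : size s = size w ->
  exists k : int, smoothing_exp w s = writhe w + 2 * (count negb s)%:Z + 4 * k.
Proof.
elim: w s => [|l w IH] [|b s] //=.
  by exists 0; rewrite /smoothing_exp /writhe !big_nil.
move=> [/IH [k e]]; rewrite smoothing_exp_cons /writhe big_cons -/(writhe w) e.
case: l.2; case: b => /=.
- by exists k; lia.
- by exists k; lia.
- by exists k; lia.
- by exists (k - 1); lia.
Qed.

Lemma diag_loops_parity n w s : valid_word n w -> size s = size w ->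
  exists k : int, (diag_loops n.+1 (smoothing w s))%:Z = n.+1%:Z + (count negb s)%:Z + 2 * k.
Proof.
move=> wv sw; have /valid_seqP cv := valid_smoothing s wv.
have := loops_parity (size (smoothing w s)) cv.
have -> : (\sum_(t < size (smoothing w s)) isSome (nth None (smoothing w s) t) = count negb s)%N.
  rewrite -(big_mkord xpredT (fun t => isSome (nth None (smoothing w s) t) : nat)).
  rewrite -(big_nth None xpredT (fun o : option nat => isSome o : nat)) /smoothing.
  rewrite big_map; elim: w s sw {wv cv} => [|l w IH] [|b s] //=; first by rewrite big_nil.
  by move=> [sw]; rewrite big_cons IH //; case: b.
rewrite -/(diag_loops _ _) -oddD => e.
have {e} : ~~ odd (diag_loops n.+1 (smoothing w s) + (n.+1 + count negb s)).
  by rewrite oddD e addbb.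
rewrite -dvdn2 => /dvdnP[k e].
exists (k%:Z - (n.+1 + count negb s)%:Z); lia.
Qed.

(** With [F] cup-caps, the exponent contributes [writhe w + 2 F] and the loops [2 (n + F)] modulo 4.
    The terms in [F] add up to [4 F], so all states lie in the same grade. *)
Lemma jones_graded n w : valid_word n w ->
  graded (2 * (n + size w)%:Z) (jones n.+1 w).
Proof.
move=> wv; have [k1 e1] := writhe_parity w.
pose z := 2 * (n + size w)%:Z - 3 * (- writhe w).
have -> : 2 * (n + size w)%:Z = 3 * (- writhe w) + z by rewrite /z; lia.
apply: gradedM; first exact: graded_twist.
rewrite bracketE; apply: graded_state_sum => s sw.
have [k2 e2] := smoothing_exp_mod4 sw.
have [k3 e3] := diag_loops_parity wv sw.
have L0 : (0 < diag_loops n.+1 (smoothing w s))%N by apply: loops_gt0.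
pose F := (count negb s)%:Z.
have := gradedM (graded_Avar (smoothing_exp w s))
  (gradedX (diag_loops n.+1 (smoothing w s)).-1 graded_loopval).
move=> /graded_mod; apply; rewrite /z.
instantiate (1 := (size w)%:Z + k1 - F - k2 - k3 ); rewrite /F; lia.
Qed.

(** Clearing denominators gives a monomial [X^k] that is a polynomial in [X^4], so 4 divides
    [k = 4 N - z]. *)
Lemma graded_one z : graded z 1 -> (4 %| z)%Z.
Proof.
move=> /(graded_large `|z|%N) [N [p [le e]]].
have [k ek] : exists k : nat, (4 * N)%:Z - z = k%:Z by exists (absz ((4 * N)%:Z - z)); lia.
move: e; rewrite mul1r ek -exprnP AvarXn => /eqP; rewrite tofrac_eq => /eqP e.
have := coef_comp_poly_Xn p k (isT : 0 < 4)%N; rewrite -e coefXn eqxx.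
by case: ifP => // /dvdnP [j ej] _; apply/dvdzP; exists (N%:Z - j%:Z); lia.
Qed.

Lemma graded_laurent z x : graded z x ->
  exists (k : nat) (p : {poly int}), x * Avar ^+ k = FracField.tofrac p.
Proof.
move=> /(graded_large `|z|%N) [N [p [le e]]].
by exists (absz ((4 * N)%:Z - z)), (p \Po 'X^4); rewrite -e exprnP; congr (_ * _ ^ _); lia.
Qed.

(** * Comparing two exponents *)

Lemma Vseq_split n k (i : 'I_k -> nat) (a : 'I_k -> int) (j : 'I_k) :
  (forall h : 'I_k, 0 < i h < n.+1)%N ->
  exists w1 w2 : bword, [/\ valid_word n w1, valid_word n w2 &
    forall e, Vseq n.+1 i a j e = jones n.+1 (w1 ++ nseq `|e|%N (i j, 0 <= e) ++ w2)].
Proof.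
move=> iv; pose wd s := word_of [seq (i h, a h) | h <- s].
have wdv s : valid_word n (wd s).
  elim: s => //= h s IH.
  by rewrite /valid_word /wd /word_of /= all_cat [all _ _ in X in _ && X]IH all_nseq /= iv orbT.
(* The enumeration has no repetition, so [j] occurs in neither [s1] nor [s2] and the outer words do
   not depend on [e]. *)
have := enum_uniq 'I_k; rewrite /Vseq; case/splitPr: (mem_enum 'I_k j) => s1 s2.
rewrite cat_uniq /= => /and3P[_ /norP[j1 _] /andP[j2 _]].
exists (wd s1), (wd s2); split=> // e; congr (jones _ _).
have wdE s : j \notin s -> wd s = word_of [seq (i h, if h == j then e else a h) | h <- s].
  move=> js; congr word_of; apply/eq_in_map => h hs.
  by case: eqP => // hj; rewrite -hj hs in js.
by rewrite !wdE // /word_of map_cat map_cat flatten_cat /= eqxx.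
Qed.

Lemma skein_quotient (F : fieldType) (A P Q : F) (a : int) (c : nat) :
  let V := fun e : int => (- A ^+ 2) ^ e * P + (A ^+ 6) ^ e * Q in
  let B := A ^+ (4 * c) in
  A != 0 -> B != 1 -> V a = 1 -> V (a + (2 * c)%:Z) = 1 ->
  V (a + 1) * (B * (B + 1)) = - (A ^+ 2 * (B * (B + 1)) + A ^+ 6 + A ^+ 2).
Proof.
move=> V B A0 B1; rewrite /V.
have A2 : - A ^+ 2 != 0 by rewrite oppr_eq0 expf_neq0.
have A6 : A ^+ 6 != 0 by rewrite expf_neq0.
rewrite !expfzDr // !expr1z -!exprnP !(mulrAC _ _ P) !(mulrAC _ _ Q).
have -> : (- A ^+ 2) ^+ (2 * c) = B.
  by rewrite exprM sqrrN -!exprM; congr (_ ^+ _); lia.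
have -> : (A ^+ 6) ^+ (2 * c) = B ^+ 3.
  by rewrite -!exprM; congr (_ ^+ _); lia.
(* [p] and [q] are the two terms of [V a], so the hypotheses read [p + q = 1] and
   [p B + q B^3 = 1]. *)
move: (_ * P) (_ * Q) => p q e1 e2.
have ep : p = 1 - q by rewrite -e1 addrK.
have e3 : (B - 1) * (q * (B * (B + 1)) + 1) = 0.
  transitivity (p * B + q * B ^+ 3 - 1); last by rewrite e2 subrr.
  by rewrite ep; ring.
have e4 : q * (B * (B + 1)) = -1.
  move/eqP: e3; rewrite mulf_eq0 subr_eq0 (negPf B1) /= addr_eq0 => /eqP //.
transitivity (- A ^+ 2 * (B * (B + 1)) + (A ^+ 6 + A ^+ 2) * (q * (B * (B + 1)))).
  by rewrite ep; ring.
by rewrite e4; ring.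
Qed.

(** [2^6 + 2^2 = 4 * 17], so the odd number [2^(4 c) + 1] divides 17 when [c > 0]. The factor
    [2 ^+ k] comes from clearing the denominator of the Laurent polynomial. *)
Lemma skein_quotient_at2 (c k : nat) (r : int) :
  r * (2 ^+ (4 * c) * (2 ^+ (4 * c) + 1)) =
    - ((2 ^+ 2 * (2 ^+ (4 * c) * (2 ^+ (4 * c) + 1)) + 2 ^+ 6 + 2 ^+ 2) * 2 ^+ k) ->
  (c <= 1)%N.
Proof.
move=> e; pose B := (2 ^ (4 * c))%N.
have pow2 m : (2 ^ m)%N%:Z = 2 ^+ m :> int by rewrite -natrX natz.
have dv : ((B + 1)%N%:Z %| ((2 ^ k * 2 ^ 2) * 17)%N%:Z)%Z.
  apply/dvdzP; exists (- (r + 2 ^+ 2 * 2 ^+ k) * 2 ^+ (4 * c)).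
  rewrite !PoszM PoszD !pow2.
  transitivity (- (r * (2 ^+ (4 * c) * (2 ^+ (4 * c) + 1)))
                - 2 ^+ 2 * 2 ^+ k * (2 ^+ (4 * c) * (2 ^+ (4 * c) + 1))); last by ring.
  by rewrite e; ring.
rewrite dvdzE !absz_nat in dv.
(* The case [c = 0] is set apart, since [B + 1 = 2] is then even. *)
case: c @B dv {e} => [|c] B dv //.
have cop : coprime (B + 1) (2 ^ k * 2 ^ 2).
  have c2 : coprime (B + 1) 2 by rewrite coprimen2 oddD /B oddX.
  by rewrite coprimeMr !coprimeXr.
rewrite Gauss_dvdr // in dv.
have := dvdn_leq (isT : 0 < 17)%N dv; rewrite /B addn1 ltnS.
by rewrite -[16%N]/(2 ^ 4)%N leq_exp2l //; lia.
Qed.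

Lemma Avar_exp_neq1 c : (0 < c)%N -> Avar ^+ (4 * c) != 1.
Proof.
move=> c0; rewrite AvarXn -[1]tofrac1 tofrac_eq.
apply/eqP => /(congr1 (fun p : {poly int} => p.[0])).
by rewrite hornerXn hornerC expr0n muln_eq0 /= eqn0Ngt c0.
Qed.

Lemma gap_eq2 n w1 w2 i (e1 e2 : int) :
  let V := fun e : int => jones n.+1 (w1 ++ nseq `|e|%N (i, 0 <= e) ++ w2) in
  valid_word n w1 -> valid_word n w2 -> (0 < i < n.+1)%N ->
  e1 < e2 -> V e1 = 1 -> V e2 = 1 -> e2 = e1 + 2.
Proof.
move=> V v1 v2 iv lt12 V1 V2.
have gV e : graded (2 * (n + size (w1 ++ nseq `|e|%N (i, 0 <= e) ++ w2))%:Z) (V e).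
  by apply: jones_graded; rewrite /valid_word !all_cat [all _ w1]v1 [all _ w2]v2 all_nseq /= iv orbT.
(* By [graded_one] both word lengths plus [n] are even, so the absolute values of [e1] and [e2] have
   the same parity. *)
have [c c0 ec] : exists2 c : nat, (0 < c)%N & e2 = e1 + (2 * c)%:Z.
  have := gV e1; have := gV e2; rewrite V1 V2 => /graded_one /dvdzP [k2 d2] /graded_one /dvdzP [k1 d1].
  move: d1 d2; rewrite !size_cat !size_nseq => d1 d2.
  have [k ek] : exists k : int, e2 - e1 = 2 * k.
    move: d1 d2; case: (e1) => m1; case: (e2) => m2 /= *.
    - by exists (k2 - k1); lia.
    - by exists (k1 - k2 - m1%:Z); lia.
    - by exists (k2 - k1 + m1.+1%:Z); lia.
    - by exists (k1 - k2); lia.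
  by exists (absz k); lia.
have [P [Q VE]] := jones_block v1 v2 iv.
have [k [r er]] := graded_laurent (gV (e1 + 1)).
rewrite -/(V _) in VE.
have := @skein_quotient _ Avar P Q e1 c Avar_neq0 (Avar_exp_neq1 c0).
rewrite -!VE -/(V _) -ec => /(_ V1 V2) key.
(* The identity of [skein_quotient], multiplied by [Avar ^+ k], descends to integer polynomials,
   where it can be evaluated at 2. *)
have pe : r * ('X^(4 * c) * ('X^(4 * c) + 1)) =
  - (('X^2 * ('X^(4 * c) * ('X^(4 * c) + 1)) + 'X^6 + 'X^2) * 'X^k).
  apply/eqP; rewrite -tofrac_eq; apply/eqP.
  rewrite tofracN !(tofracM, tofracD, tofrac1) -er -!AvarXn.
  transitivity (V (e1 + 1) * (Avar ^+ (4 * c) * (Avar ^+ (4 * c) + 1)) * Avar ^+ k).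
    exact: mulrAC.
  by rewrite key mulNr.
have h2 := congr1 (fun p : {poly int} => p.[2]) pe.
have cle : (c <= 1)%N.
  apply: (@skein_quotient_at2 c k r.[2]).
  by move: h2; rewrite !(hornerXn, hornerN, hornerM, hornerD, hornerC).
by rewrite ec; case: c c0 cle {key pe h2 ec} => [|[|c]].
Qed.

Theorem theorem1p7 (n k : nat) (i : 'I_k -> nat) (a : 'I_k -> int) (j : 'I_k) :
  (2 <= n)%N -> (1 <= k)%N ->
  (forall h : 'I_k, (1 <= i h <= n.-1)%N) ->
  (forall e1 e2 e3 : int,
      Vseq n i a j e1 = 1 -> Vseq n i a j e2 = 1 -> Vseq n i a j e3 = 1 ->
      e1 = e2 \/ e1 = e3 \/ e2 = e3) /\
  (forall e1 e2 : int, e1 <> e2 ->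
      Vseq n i a j e1 = 1 -> Vseq n i a j e2 = 1 -> `|e1 - e2| = 2).
Proof.
case: n => // n _ _ iv.
have [w1 [w2 [v1 v2 VE]]] := @Vseq_split n k i a j iv.
have gap e1 e2 : e1 < e2 -> Vseq n.+1 i a j e1 = 1 -> Vseq n.+1 i a j e2 = 1 -> e2 = e1 + 2.
  by rewrite !VE; apply: gap_eq2.
have gap_abs e1 e2 : e1 <> e2 -> Vseq n.+1 i a j e1 = 1 -> Vseq n.+1 i a j e2 = 1 ->
    `|e1 - e2| = 2.
  move=> ne V1 V2; have [lt|lt] : e1 < e2 \/ e2 < e1 by lia.
    by have := gap _ _ lt V1 V2; lia.
  by have := gap _ _ lt V2 V1; lia.
split=> // e1 e2 e3 V1 V2 V3.
have [|/eqP ne12] := eqVneq e1 e2; first by left.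
have [|/eqP ne13] := eqVneq e1 e3; first by right; left.
have [|/eqP ne23] := eqVneq e2 e3; first by right; right.
(* Three integers cannot be pairwise at distance 2, since the extreme ones would be at distance
   4. *)
have := gap_abs _ _ ne12 V1 V2; have := gap_abs _ _ ne13 V1 V3.
have := gap_abs _ _ ne23 V2 V3; lia.
Qed.
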